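(* There exist connected topological spaces $E$ and $B$, with $B$ simply connected, and a two-fold covering map $p:E\to B$.
   Context: A space is simply connected if it is path-connected and has trivial fundamental group. A two-fold covering map is a covering map each of whose fibers has exactly two points. No local path-connectedness is assumed of $E$ or $B$. *)

(* Defs.v *)
From HB Require Import structures.
From mathcomp Require Import all_boot all_order all_algebra generic_quotient.
From mathcomp Require Import all_classical all_reals topology normedtype.
From mathcomp Require Import homotopy.
From mathcomp Require Import ring lra.

Set Implicit Arguments.
Unset Strict Implicit.
Unset Printing Implicit Defensive.

Import Order.TTheory GRing.Theory Num.Theory.
Import numFieldNormedType.Exports.

Local Open Scope classical_set_scope.
Local Open Scope ring_scope.
Local Open Scope quotient_scope.
Local Open Scope card_scope.

Section unit_interval.
Variable R : realType.

Definition unit_interval : Type := set_type (`[0, 1]%classic : set R).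

HB.instance Definition _ := Topological.copy unit_interval
  (set_type (`[0, 1]%classic : set R)).

Lemma in_unit_interval (t : R) : 0 <= t <= 1 -> t \in (`[0, 1]%classic : set R).
Proof. by move=> t01; apply/mem_set; rewrite /= in_itv. Qed.

Definition ui (t : R) (t01 : 0 <= t <= 1) : unit_interval :=
  exist _ t (in_unit_interval t01).

Definition uval (t : unit_interval) : R := set_val t.

Lemma uvalP (t : unit_interval) : 0 <= uval t <= 1.
Proof. by have := set_valP t; rewrite /= in_itv. Qed.

Lemma uval_inj : injective uval.
Proof. by move=> s t; exact: val_inj. Qed.

Lemma ui0_subproof : 0 <= (0 : R) <= 1. Proof. by rewrite lexx ler01. Qed.
Lemma ui1_subproof : 0 <= (1 : R) <= 1. Proof. by rewrite ler01 lexx. Qed.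

Lemma ui_neq01 : ui ui0_subproof != ui ui1_subproof.
Proof.
by apply/eqP => /(congr1 uval)/eqP; rewrite /= eq_sym oner_eq0.
Qed.

HB.instance Definition _ := isBiPointed.Build unit_interval ui_neq01.

Lemma uval0 : uval zero = 0. Proof. by []. Qed.
Lemma uval1 : uval one = 1. Proof. by []. Qed.

Lemma clamp_subproof (t : R) : 0 <= Num.min 1 (Num.max 0 t) <= 1.
Proof. by rewrite le_min ler01 le_max lexx ge_min lexx. Qed.

Definition clamp (t : R) : unit_interval := ui (clamp_subproof t).

Lemma clampK (t : R) : 0 <= t <= 1 -> uval (clamp t) = t.
Proof.
move=> /andP[t0 t1]; rewrite /uval set_valE /=.
by rewrite [Num.max _ _]max_r// [Num.min _ _]min_r.
Qed.

Lemma uvalK (t : unit_interval) : clamp (uval t) = t.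
Proof. by apply: uval_inj; rewrite clampK// uvalP. Qed.

Lemma clamp0 : clamp 0 = zero.
Proof. by apply: uval_inj; rewrite clampK// lexx ler01. Qed.

Lemma clamp1 : clamp 1 = one.
Proof. by apply: uval_inj; rewrite clampK// lexx ler01. Qed.

Lemma uval_continuous : continuous uval.
Proof. exact: initial_continuous. Qed.

Lemma clamp_continuous : continuous clamp.
Proof.
apply: continuous_comp_initial.
apply: (@min_fun_continuous _ R R (cst 1) (cst 0 \max id)).
  by move=> t; exact: cvg_cst.
by apply: (@max_fun_continuous _ R R) => t; [exact: cvg_cst|exact: cvg_id].
Qed.

End unit_interval.

Notation upath R x y := {path (unit_interval R) from x to y}.

Lemma continuous_glue (R : realType) (X T : topologicalType) (h : X -> R)
    (c : R) (u v : X -> T) :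
  continuous h -> continuous u -> continuous v ->
  (forall a, h a = c -> u a = v a) ->
  continuous (fun a => if h a <= c then u a else v a).
Proof.
move=> ch cu cv uv; apply/continuous_subspace_setT.
have -> : [set: X] = h @^-1` [set t | t <= c] `|` h @^-1` [set t | c <= t].
  apply/seteqP; split => // a _.
  by case: (leP (h a) c) => [?|/ltW ?]; [left|right].
apply: withinU_continuous.
- by apply: closed_comp; [move=> ? ?; exact: ch|exact: closed_le].
- by apply: closed_comp; [move=> ? ?; exact: ch|exact: closed_ge].
- apply: (@subspace_eq_continuous _ _ _ u) => [a|].
    by rewrite inE => /= ac; rewrite /from_subspace ac.
  exact: continuous_subspaceT.
- apply: (@subspace_eq_continuous _ _ _ v) => [a|].
    rewrite inE /from_subspace => /= ca; case: ifPn => // ac; apply/esym/uv/eqP.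
    by rewrite eq_le ac ca.
  exact: continuous_subspaceT.
Qed.

Section path_operations.
Variables (R : realType) (T : topologicalType).
Local Notation I := (unit_interval R).

(* Homotopy relative to the endpoints: t is the path parameter and s the
   deformation parameter in H (t, s). *)
Definition homotopic (x y : T) (f g : upath R x y) : Prop :=
  exists H : I * I -> T,
    [/\ continuous H,
        (forall t, H (t, zero) = f t) /\ (forall t, H (t, one) = g t),
        forall s, H (zero, s) = x &
        forall s, H (one, s) = y].

Definition const_path (x : T) : upath R x x := (cst x : I -> T).

Definition concat_fun (f g : I -> T) (t : I) : T :=
  if uval t <= 2^-1 then f (clamp (2 * uval t))
  else g (clamp (2 * uval t - 1)).

Definition reverse_fun (f : I -> T) (t : I) : T := f (clamp (1 - uval t)).

Lemma continuous_clamp (X : topologicalType) (f : I -> T) (u : X -> R) :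
  continuous f -> continuous u -> continuous (f \o (@clamp R \o u)).
Proof.
move=> cf cu a; apply: continuous_comp; last exact: cf.
by apply: continuous_comp; [exact: cu|exact: clamp_continuous].
Qed.

Lemma continuous_affine (X : topologicalType) (u : X -> R) (a b : R) :
  continuous u -> continuous (fun z => a * u z + b).
Proof.
move=> cu z; apply: cvgD; last exact: cvg_cst.
by apply: cvgM; [exact: cvg_cst|exact: cu].
Qed.

Lemma continuous_onem (X : topologicalType) (u : X -> R) :
  continuous u -> continuous (fun z => 1 - u z).
Proof.
move=> /(continuous_affine (a := -1) (b := 1)).
by under eq_fun do rewrite mulN1r addrC.
Qed.

Lemma concat_fun_continuous (f g : I -> T) :
  continuous f -> continuous g -> f one = g zero ->
  continuous (concat_fun f g).
Proof.
move=> cf cg fg; apply: continuous_glue.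
- exact: uval_continuous.
- apply: (@continuous_clamp _ f (fun t => 2 * uval t)) => //.
  have := continuous_affine (a := 2) (b := 0) (@uval_continuous R).
  by under eq_fun do rewrite addr0.
- apply: (@continuous_clamp _ g (fun t => 2 * uval t - 1)) => //.
  exact: continuous_affine (@uval_continuous R).
- move=> a ->; rewrite divff ?pnatr_eq0// subrr clamp1 clamp0.
  exact: fg.
Qed.

Lemma reverse_fun_continuous (f : I -> T) :
  continuous f -> continuous (reverse_fun f).
Proof.
move=> cf; apply: (@continuous_clamp _ f (fun t => 1 - uval t)) => //.
exact: continuous_onem (@uval_continuous R).
Qed.

Lemma concat_fun0 (f g : I -> T) : concat_fun f g zero = f zero.
Proof. by rewrite /concat_fun uval0 invr_ge0 ler0n mulr0 clamp0. Qed.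

Lemma concat_fun1 (f g : I -> T) : concat_fun f g one = g one.
Proof.
rewrite /concat_fun uval1 ifF; last by apply/negbTE; rewrite -ltNge; lra.
by rewrite mulr1 (_ : 2 - 1 = 1) ?clamp1//; lra.
Qed.

Lemma concat_funl (f g : I -> T) (s : R) :
  0 <= s <= 2^-1 -> concat_fun f g (clamp s) = f (clamp (2 * s)).
Proof.
by move=> /andP[s0 s2]; rewrite /concat_fun clampK ?s2//; lra.
Qed.

Lemma concat_funr (f g : I -> T) (s : R) :
  2^-1 < s <= 1 -> concat_fun f g (clamp s) = g (clamp (2 * s - 1)).
Proof.
move=> /andP[s2 s1]; rewrite /concat_fun clampK; last by lra.
by rewrite leNgt s2.
Qed.

Section concat.
Variables (x y z : T) (f : upath R x y) (g : upath R y z).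

Lemma concat_continuous : continuous (concat_fun f g).
Proof.
apply: concat_fun_continuous; [exact: cts_fun..|].
by rewrite path_one path_zero.
Qed.

Lemma concat_zero : concat_fun f g zero = x.
Proof. by rewrite concat_fun0 path_zero. Qed.

Lemma concat_one : concat_fun f g one = z.
Proof. by rewrite concat_fun1 path_one. Qed.

Definition concat : upath R x z :=
  mk_path concat_continuous concat_zero concat_one.

End concat.

Section reverse.
Variables (x y : T) (f : upath R x y).

Lemma reverse_continuous : continuous (reverse_fun f).
Proof. by apply: reverse_fun_continuous; exact: cts_fun. Qed.

Lemma reverse_zero : reverse_fun f zero = y.
Proof. by rewrite /reverse_fun uval0 subr0 clamp1 path_one. Qed.

Lemma reverse_one : reverse_fun f one = x.
Proof. by rewrite /reverse_fun uval1 subrr clamp0 path_zero. Qed.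

Definition reverse : upath R y x :=
  mk_path reverse_continuous reverse_zero reverse_one.

End reverse.

Lemma continuous_pair_fun (X Y Z : topologicalType) (u : X -> Y) (v : X -> Z) :
  continuous u -> continuous v -> continuous (fun a => (u a, v a)).
Proof. by move=> cu cv a; apply: cvg_pair; [exact: cu|exact: cv]. Qed.

Lemma continuous_pairl (H : I * I -> T) (u : I * I -> R) : continuous H ->
  continuous u -> continuous (fun ts : I * I => H (clamp (u ts), ts.2)).
Proof.
move=> cH cu ts; apply: (@continuous_comp _ _ _
  (fun ts : I * I => (clamp (u ts), ts.2)) H); last exact: cH.
apply: (continuous_pair_fun (u := @clamp R \o u)) => [a|a]; last exact: cvg_snd.
by apply: continuous_comp; [exact: cu|exact: clamp_continuous].
Qed.

Lemma continuous_pairr (H : I * I -> T) (u : I * I -> R) : continuous H ->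
  continuous u -> continuous (fun ts : I * I => H (ts.1, clamp (u ts))).
Proof.
move=> cH cu ts; apply: (@continuous_comp _ _ _
  (fun ts : I * I => (ts.1, clamp (u ts))) H); last exact: cH.
apply: (continuous_pair_fun (v := @clamp R \o u)) => [a|a].
  exact: cvg_fst.
by apply: continuous_comp; [exact: cu|exact: clamp_continuous].
Qed.

Lemma continuous_uval1 : continuous (fun ts : I * I => uval ts.1).
Proof.
by move=> ts; apply: continuous_comp; [exact: cvg_fst|exact: uval_continuous].
Qed.

Lemma continuous_uval2 : continuous (fun ts : I * I => uval ts.2).
Proof.
by move=> ts; apply: continuous_comp; [exact: cvg_snd|exact: uval_continuous].
Qed.

Lemma homotopic_reparam (x y : T) (f g : upath R x y) (h : I -> T)
    (u v : I -> R) :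
  continuous h -> continuous u -> continuous v ->
  u zero = v zero -> u one = v one ->
  (forall t, f t = h (clamp (u t))) -> (forall t, g t = h (clamp (v t))) ->
  homotopic f g.
Proof.
move=> ch cu cv uv0 uv1 fh gh.
exists (h \o (@clamp R \o
  (fun ts => (1 - uval ts.2) * u ts.1 + uval ts.2 * v ts.1))).
split.
- apply: continuous_clamp => // -[t s].
  apply: cvgD; apply: cvgM; [exact: continuous_onem continuous_uval2 _| |
    exact: continuous_uval2|].
  + by apply: continuous_comp; [exact: cvg_fst|exact: cu].
  + by apply: continuous_comp; [exact: cvg_fst|exact: cv].
- split=> t /=; first by rewrite uval0 subr0 mul0r mul1r addr0 fh.
  by rewrite uval1 subrr mul0r mul1r add0r gh.
- by move=> s /=; rewrite -uv0 -mulrDl subrK mul1r -fh path_zero.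
- by move=> s /=; rewrite -uv1 -mulrDl subrK mul1r -fh path_one.
Qed.

Lemma homotopic_refl (x y : T) (f : upath R x y) : homotopic f f.
Proof.
apply: (@homotopic_reparam _ _ f f f (@uval R) (@uval R)) => //;
  by [exact: cts_fun|exact: uval_continuous|move=> t; rewrite uvalK].
Qed.

Lemma homotopic_sym (x y : T) (f g : upath R x y) :
  homotopic f g -> homotopic g f.
Proof.
move=> [H [cH [Hf Hg] H0 H1]].
exists (fun ts => H (ts.1, clamp (1 - uval ts.2))); split.
- by apply: continuous_pairr => //; exact: continuous_onem continuous_uval2.
- by split=> t /=; rewrite ?uval0 ?uval1 ?subr0 ?subrr ?clamp0 ?clamp1.
- by move=> s /=; rewrite H0.
- by move=> s /=; rewrite H1.
Qed.

Lemma homotopic_trans (x y : T) (f g h : upath R x y) :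
  homotopic f g -> homotopic g h -> homotopic f h.
Proof.
move=> [H [cH [Hf Hg] H0 H1]] [K [cK [Kg Kh] K0 K1]].
exists (fun ts => if uval ts.2 <= 2^-1 then H (ts.1, clamp (2 * uval ts.2 + 0))
                  else K (ts.1, clamp (2 * uval ts.2 - 1))); split.
- apply: continuous_glue.
  + exact: continuous_uval2.
  + by apply: continuous_pairr => //; exact: continuous_affine continuous_uval2.
  + by apply: continuous_pairr => //; exact: continuous_affine continuous_uval2.
  + by move=> ts ->; rewrite addr0 divff ?pnatr_eq0// subrr clamp1 clamp0 Hg Kg.
- split=> t /=.
    by rewrite uval0 invr_ge0 ler0n mulr0 addr0 clamp0.
  rewrite uval1 ifF; last by apply/negbTE; rewrite -ltNge; lra.
  by rewrite mulr1 (_ : 2 - 1 = 1) ?clamp1//; lra.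
- by move=> s /=; rewrite H0 K0 if_same.
- by move=> s /=; rewrite H1 K1 if_same.
Qed.

Lemma homotopic_concat (x y z : T) (f f' : upath R x y) (g g' : upath R y z) :
  homotopic f f' -> homotopic g g' ->
  homotopic (concat f g) (concat f' g').
Proof.
move=> [H [cH [Hf Hf'] H0 H1]] [K [cK [Kg Kg'] K0 K1]].
exists (fun ts => if uval ts.1 <= 2^-1 then H (clamp (2 * uval ts.1 + 0), ts.2)
                  else K (clamp (2 * uval ts.1 - 1), ts.2)); split.
- apply: continuous_glue.
  + exact: continuous_uval1.
  + by apply: continuous_pairl => //; exact: continuous_affine continuous_uval1.
  + by apply: continuous_pairl => //; exact: continuous_affine continuous_uval1.
  + by move=> ts ->; rewrite addr0 divff ?pnatr_eq0// subrr clamp1 clamp0 H1 K0.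
- by split=> t /=; rewrite /mk_path /concat_fun addr0;
    case: ifP; rewrite ?Hf ?Kg ?Hf' ?Kg'.
- by move=> s /=; rewrite uval0 invr_ge0 ler0n mulr0 addr0 clamp0.
- move=> s /=; rewrite uval1 ifF; last by apply/negbTE; rewrite -ltNge; lra.
  by rewrite mulr1 (_ : 2 - 1 = 1) ?clamp1//; lra.
Qed.

Lemma homotopic_reverse (x y : T) (f g : upath R x y) :
  homotopic f g -> homotopic (reverse f) (reverse g).
Proof.
move=> [H [cH [Hf Hg] H0 H1]].
exists (fun ts => H (clamp (1 - uval ts.1), ts.2)); split.
- by apply: continuous_pairl => //; exact: continuous_onem continuous_uval1.
- by split=> t /=; rewrite ?Hf ?Hg.
- by move=> s /=; rewrite uval0 subr0 clamp1.
- by move=> s /=; rewrite uval1 subrr clamp0.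
Qed.

Lemma concatA (x y z w : T) (f : upath R x y) (g : upath R y z)
    (h : upath R z w) :
  homotopic (concat f (concat g h)) (concat (concat f g) h).
Proof.
pose u (t : I) := if uval t <= 2^-1 then
  (if uval t <= 4^-1 then 2 * uval t + 0 else 1 * uval t + 4^-1)
  else 2^-1 * uval t + 2^-1.
have cu : continuous u.
  have cI := @uval_continuous R.
  apply: continuous_glue => //; last by move=> t ->; rewrite ifF; lra.
  - apply: continuous_glue => //; try exact: continuous_affine.
    by move=> t ->; lra.
  - exact: continuous_affine.
apply: (@homotopic_reparam _ _ _ _ (concat f (concat g h)) (@uval R) u) => //.
- exact: cts_fun.
- exact: uval_continuous.
- by rewrite /u uval0 !invr_ge0 !ler0n; lra.
- by rewrite /u uval1 ifF; lra.
- by move=> t; rewrite uvalK.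
- move=> t; have /andP[t0 t1] := uvalP t.
  rewrite -[t in LHS]uvalK /= /mk_path /u.
  have [t2|t2] := leP (uval t) 2^-1.
    rewrite [LHS]concat_funl; last by lra.
    have [t4|t4] := leP (uval t) 4^-1.
      rewrite /= concat_funl; last by lra.
      rewrite concat_funl; last by lra.
      by rewrite addr0.
    rewrite /= concat_funr; last by lra.
    rewrite concat_funr; last by lra.
    rewrite /= concat_funl; last by lra.
    by congr (g (clamp _)); lra.
  rewrite concat_funr; last by lra.
  rewrite concat_funr; last by lra.
  rewrite /= concat_funr; last by lra.
  by congr (h (clamp _)); lra.
Qed.

Lemma concat1p (x y : T) (f : upath R x y) :
  homotopic (concat (const_path x) f) f.
Proof.
pose u (t : I) := if uval t <= 2^-1 then 0 * uval t + 0 else 2 * uval t + -1.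
have cu : continuous u.
  have cI := @uval_continuous R.
  apply: continuous_glue => //; try exact: continuous_affine.
  by move=> t ->; lra.
apply: (@homotopic_reparam _ _ _ _ f u (@uval R)) => //.
- exact: cts_fun.
- exact: uval_continuous.
- by rewrite /u uval0 !invr_ge0 !ler0n; lra.
- by rewrite /u uval1 ifF; lra.
- move=> t; rewrite /= /mk_path /concat_fun /u; case: ifP => // _.
  by rewrite mul0r addr0 clamp0 path_zero.
- by move=> t; rewrite uvalK.
Qed.

Lemma concatp1 (x y : T) (f : upath R x y) :
  homotopic (concat f (const_path y)) f.
Proof.
pose u (t : I) := if uval t <= 2^-1 then 2 * uval t + 0 else 0 * uval t + 1.
have cu : continuous u.
  have cI := @uval_continuous R.
  apply: continuous_glue => //; try exact: continuous_affine.
  by move=> t ->; lra.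
apply: (@homotopic_reparam _ _ _ _ f u (@uval R)) => //.
- exact: cts_fun.
- exact: uval_continuous.
- by rewrite /u uval0 !invr_ge0 !ler0n; lra.
- by rewrite /u uval1 ifF; lra.
- move=> t; rewrite /= /mk_path /concat_fun /u; case: ifP => _.
    by rewrite addr0.
  by rewrite mul0r add0r clamp1 path_one.
- by move=> t; rewrite uvalK.
Qed.

Lemma concatpV (x y : T) (f : upath R x y) :
  homotopic (concat f (reverse f)) (const_path x).
Proof.
pose u (t : I) := if uval t <= 2^-1 then 2 * uval t + 0 else -2 * uval t + 2.
have cu : continuous u.
  have cI := @uval_continuous R.
  apply: continuous_glue => //; try exact: continuous_affine.
  by move=> t ->; lra.
apply: (@homotopic_reparam _ _ _ _ f u (cst 0)) => //.
- exact: cts_fun.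
- move=> t; exact: (@cst_continuous I R 0 t).
- by rewrite /u uval0 !invr_ge0 !ler0n mulr0 addr0.
- by rewrite /u uval1 ifF => [|]; [rewrite mulr1 addNr|lra].
- move=> t; have /andP[t0 t1] := uvalP t.
  rewrite /= /mk_path /concat_fun /u; case: leP => t2.
    by rewrite addr0.
  rewrite /= /mk_path /reverse_fun clampK; last by lra.
  by congr (f (clamp _)); lra.
- by move=> t /=; rewrite clamp0 path_zero.
Qed.

Lemma reverseK (x y : T) (f : upath R x y) : homotopic (reverse (reverse f)) f.
Proof.
apply: (@homotopic_reparam _ _ _ _ f (@uval R) (@uval R)) => //.
- exact: cts_fun.
- exact: uval_continuous.
- exact: uval_continuous.
- move=> t; have /andP[t0 t1] := uvalP t.
  rewrite /= /mk_path /reverse_fun /= /mk_path /reverse_fun clampK; last by lra.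
  by congr (f (clamp _)); lra.
- by move=> t; rewrite uvalK.
Qed.

Lemma concatVp (x y : T) (f : upath R x y) :
  homotopic (concat (reverse f) f) (const_path y).
Proof.
apply: homotopic_trans (concatpV (reverse f)).
apply: homotopic_concat; first exact: homotopic_refl.
exact/homotopic_sym/reverseK.
Qed.

End path_operations.

Section fundamental_group.
Variables (R : realType) (T : topologicalType) (x : T).
Local Notation loop := (upath R x x).

Definition loop_homotopic (f g : loop) : bool := `[< homotopic f g >].

Lemma loop_homotopic_equiv : equiv_class_of loop_homotopic.
Proof.
split=> [f|f g|g f h].
- exact/asboolP/homotopic_refl.
- by apply/asboolP/asboolP; exact: homotopic_sym.
- by move=> /asboolP fg /asboolP gh; apply/asboolP; exact: homotopic_trans gh.
Qed.

Canonical loop_homotopic_equivRel := EquivRelPack loop_homotopic_equiv.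

Definition fundamental_group : Type := {eq_quot loop_homotopic}.

HB.instance Definition _ := Choice.on fundamental_group.

Definition loop_class (f : loop) : fundamental_group :=
  \pi_{eq_quot loop_homotopic} f.

Lemma loop_class_eqP (f g : loop) :
  loop_class f = loop_class g <-> homotopic f g.
Proof.
split; first by move=> /eqmodP/asboolP.
by move=> fg; apply/eqmodP/asboolP.
Qed.

Lemma loop_class_repr (a : fundamental_group) : loop_class (repr a) = a.
Proof. exact: reprK. Qed.

Lemma homotopic_repr (f : loop) : homotopic (repr (loop_class f)) f.
Proof. by apply/loop_class_eqP; rewrite loop_class_repr. Qed.

Definition pi1_one : fundamental_group := loop_class (const_path R x).
Definition pi1_mul (a b : fundamental_group) : fundamental_group :=
  loop_class (concat (repr a) (repr b)).
Definition pi1_inv (a : fundamental_group) : fundamental_group :=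
  loop_class (reverse (repr a)).

Lemma pi1_mulE (f g : loop) :
  pi1_mul (loop_class f) (loop_class g) = loop_class (concat f g).
Proof. by apply/loop_class_eqP/homotopic_concat; exact: homotopic_repr. Qed.

Lemma pi1_invE (f : loop) : pi1_inv (loop_class f) = loop_class (reverse f).
Proof. by apply/loop_class_eqP/homotopic_reverse; exact: homotopic_repr. Qed.

Lemma pi1_mulA : associative pi1_mul.
Proof.
move=> a b c.
rewrite -[a]loop_class_repr -[b]loop_class_repr -[c]loop_class_repr.
by rewrite !pi1_mulE; apply/loop_class_eqP/concatA.
Qed.

Lemma pi1_mul1 : left_id pi1_one pi1_mul.
Proof.
move=> a; rewrite -[a]loop_class_repr pi1_mulE.
exact/loop_class_eqP/concat1p.
Qed.

Lemma pi1_mulr1 : right_id pi1_one pi1_mul.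
Proof.
move=> a; rewrite -[a]loop_class_repr pi1_mulE.
exact/loop_class_eqP/concatp1.
Qed.

Lemma pi1_mulV : left_inverse pi1_one pi1_inv pi1_mul.
Proof.
move=> a; rewrite -[a]loop_class_repr pi1_invE pi1_mulE.
exact/loop_class_eqP/concatVp.
Qed.

Lemma pi1_mulrV : right_inverse pi1_one pi1_inv pi1_mul.
Proof.
move=> a; rewrite -[a]loop_class_repr pi1_invE pi1_mulE.
exact/loop_class_eqP/concatpV.
Qed.

HB.instance Definition _ := isGroup.Build fundamental_group
  pi1_mulA pi1_mul1 pi1_mulr1 pi1_mulV pi1_mulrV.

End fundamental_group.

(* The empty space does not count as path-connected: otherwise it would be
   simply connected and would be a covering of itself with any number of
   sheets. *)
Definition path_connected (R : realType) (T : topologicalType) : Prop :=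
  [set: T] !=set0 /\ forall x y : T, $|upath R x y|.

Definition simply_connected (R : realType) (T : topologicalType) : Prop :=
  path_connected R T /\
  forall (x : T) (a : fundamental_group R x), a = 1%g.

(* V and U, used as types, carry the subspace topology. *)
Definition restricts_to_homeomorphism (X Y : topologicalType) (p : X -> Y)
    (V : set X) (U : set Y) : Prop :=
  exists (f : V -> U) (g : U -> V),
    [/\ forall v, set_val (f v) = p (set_val v),
        continuous f, continuous g, cancel f g & cancel g f].

(* S is the set of sheets over U. *)
Definition evenly_covered (X Y : topologicalType) (p : X -> Y)
    (U : set Y) : Prop :=
  exists S : set_system X,
    [/\ \bigcup_(V in S) V = p @^-1` U, trivIset S id &
        forall V, S V -> open V /\ restricts_to_homeomorphism p V U].

Definition covering_map (X Y : topologicalType) (p : X -> Y) : Prop :=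
  [/\ continuous p, set_surj [set: X] [set: Y] p &
      forall y : Y, exists U : set Y, [/\ open U, U y & evenly_covered p U]].

Definition two_fold_covering_map (X Y : topologicalType) (p : X -> Y) : Prop :=
  covering_map p /\ forall y : Y, (p @^-1` [set y]) #= `I_2.

(* Main.v *)
Require Import Defs.
From HB Require Import structures.
From mathcomp Require Import all_boot all_order all_algebra.
From mathcomp Require Import all_classical all_reals topology normedtype.
From mathcomp Require Import homotopy.
From mathcomp Require Import lra.

Set Implicit Arguments.
Unset Strict Implicit.
Unset Printing Implicit Defensive.

Import Order.TTheory GRing.Theory Num.Theory.
Import numFieldNormedType.Exports.

Local Open Scope classical_set_scope.
Local Open Scope ring_scope.
Local Open Scope card_scope.

(** A line with its far end glued near the origin, as in the Warsaw circle: B is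
    the real line R in which every neighbourhood of 0 must also contain a
    neighbourhood of all large natural numbers. A path of B that is at 0 cannot
    leave through the small disjoint intervals around these integers, hence the
    paths of B are those of R, and straight-line homotopies contract the loops.
    For E, take two copies of R and let the far integers of each copy accumulate
    at the origin of the other one. The copies are the path components of E, but
    each has the other origin in its closure, so E is connected. *)

(** * Open maps and homeomorphic sheets *)

Lemma open_map_sheet (X Y : topologicalType) (p : X -> Y) (V : set X)
    (U : set Y) :
  continuous p -> (forall O, open O -> open (p @` O)) -> open V ->
  {in V &, injective p} -> p @` V = U -> restricts_to_homeomorphism p V U.
Proof.
move=> cp op oV injp pVU.
have fP (v : V) : p (set_val v) \in U.
  by apply/mem_set; rewrite -pVU; exists (set_val v) => //; exact: set_valP.
have gP (u : U) : exists v : V, p (set_val v) = set_val u.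
  have [] : (p @` V) (set_val u) by rewrite pVU; exact: set_valP.
  by move=> x Vx <-; exists (exist _ x (mem_set Vx)).
have [g gE] := choice gP.
pose f (v : V) : U := exist _ (p (set_val v)) (fP v).
have gK : cancel g f by move=> u; apply: val_inj; exact: gE.
exists f, g; split => //.
- apply: continuous_comp_initial => v.
  apply: (@continuous_comp _ _ _ set_val p); last exact: cp.
  exact: initial_continuous.
- apply: continuous_comp_initial; apply/continuousP => O oO.
  (* Injectivity of [p] on [V] identifies this preimage with the trace on [U] of an image under [p],
     and [p] is open. *)
  have -> : (set_val \o g) @^-1` O = set_val @^-1` (p @` (V `&` O)).
    apply/seteqP; split=> [u Ogu|u [x [Vx Ox] pxu]] /=.
      by exists (set_val (g u)) => //; split => //; exact: set_valP.
    suff -> : set_val (g u) = x by [].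
    by apply: injp; rewrite ?gE// inE//; exact: set_valP.
  by exists (p @` (V `&` O)) => //; apply: op; exact: openI.
- move=> v; apply: val_inj; apply: injp; [exact: valP|exact: valP|].
  exact: gE.
Qed.

(** After a shift by 1/2, this keeps half-integers out of the intervals used in
    [separating_nbhs]. *)
Lemma natr_gap (R : numDomainType) (n m : nat) :
  ~ (n%:R < (m%:R : R) < n%:R + 1).
Proof. by rewrite natr1 !ltr_nat ltnS => /andP[nm]; rewrite leqNgt nm. Qed.

(** * The two topologies *)

Section returning_line.
Variable R : realType.

(** An alias that inherits only the choice structure, so that it can carry a coarser topology; sets
    and maps pass between the two readings by conversion. *)
Definition returning_line : Type := R.

HB.instance Definition _ := Choice.copy returning_line R.

Definition returning_line_open (U : set returning_line) : Prop :=
  open (U : set R) /\ (U 0 -> \forall n \near \oo, U n%:R).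

Fact returning_line_openT : returning_line_open setT.
Proof. by split=> [|_]; [exact: openT|exact: filterT]. Qed.

Fact returning_line_openI : setI_closed returning_line_open.
Proof.
move=> U V [oU U0] [oV V0]; split=> [|[/U0 ? /V0 ?]]; first exact: openI.
exact: filterI.
Qed.

Fact returning_line_open_bigU (I : Type) (f : I -> set returning_line) :
  (forall i, returning_line_open (f i)) -> returning_line_open (\bigcup_i f i).
Proof.
move=> fo; split=> [|[i _ fi0]].
  by apply: bigcup_open => i _; have [] := fo i.
by apply: filterS ((fo i).2 fi0) => n ?; exists i.
Qed.

HB.instance Definition _ := isOpenTopological.Build returning_line
  returning_line_openT returning_line_openI returning_line_open_bigU.

Lemma open_returning_lineP (U : set returning_line) :
  open U <-> open (U : set R) /\ (U 0 -> \forall n \near \oo, U n%:R).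
Proof. by []. Qed.

Definition returning_cover : Type := (R * bool)%type.

HB.instance Definition _ := Choice.copy returning_cover (R * bool)%type.

Definition returning_cover_open (U : set returning_cover) : Prop :=
  forall i, open [set x : R | U (x, i)] /\
    (U (0, i) -> \forall n \near \oo, U (n%:R, ~~ i)).

Fact returning_cover_openT : returning_cover_open setT.
Proof. by move=> i; split=> [|_]; [exact: openT|exact: filterT]. Qed.

Fact returning_cover_openI : setI_closed returning_cover_open.
Proof.
move=> U V oU oV i; have [[{}oU U0] [{}oV V0]] := (oU i, oV i).
split=> [|[/U0 ? /V0 ?]]; first exact: openI oU oV.
exact: filterI.
Qed.

Fact returning_cover_open_bigU (I : Type) (f : I -> set returning_cover) :
  (forall i, returning_cover_open (f i)) ->
  returning_cover_open (\bigcup_i f i).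
Proof.
move=> fo j; split=> [|[i _ fi0]].
  exact: (bigcup_open (f := fun i => [set x | f i (x, j)])
    (fun i _ => (fo i j).1)).
by apply: filterS ((fo i j).2 fi0) => n ?; exists i.
Qed.

HB.instance Definition _ := isOpenTopological.Build returning_cover
  returning_cover_openT returning_cover_openI returning_cover_open_bigU.

Lemma open_returning_coverP (U : set returning_cover) :
  open U <-> forall i, open [set x : R | U (x, i)] /\
    (U (0, i) -> \forall n \near \oo, U (n%:R, ~~ i)).
Proof. by split=> oU; exact: oU. Qed.

(** * The projection as a two-fold covering *)

Definition returning_proj (e : returning_cover) : returning_line := e.1.

Lemma returning_proj_continuous : continuous returning_proj.
Proof.
apply/continuousP => U /open_returning_lineP[oU U0].
by apply/open_returning_coverP => i; split.
Qed.

(** If one slice of [U] contains its origin, the other slice contains the far integers, so the union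
    of the slices satisfies the condition at 0. *)
Lemma returning_proj_open (U : set returning_cover) :
  open U -> open (returning_proj @` U).
Proof.
move=> oU; have -> : returning_proj @` U =
    [set x | U (x, true)] `|` [set x | U (x, false)].
  apply/seteqP; split=> [_ [[x []] Ux <-]|x [] Ux]; [by left|by right| |].
  - by exists (x, true).
  - by exists (x, false).
have /open_returning_coverP oU' := oU.
have [[oU1 U1] [oU2 U2]] := (oU' true, oU' false).
apply/open_returning_lineP; split; first exact: openU oU1 oU2.
case=> [/U1|/U2]; apply: filterS => n Un; [by right|by left].
Qed.

(* Past c the sheet changes line: in this way the sheet i contains the far
   integers that accumulate at (0, i). *)
Definition returning_sheet (c : R) (i : bool) : set returning_cover :=
  [set e | e.1 <> c /\ e.2 = i (+) (c < e.1)].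

(** The bounds put 0 before [c], or remove it when [c = 0], and put every positive integer past [c].
    So far integers lie on the line opposite to the origin of the sheet, as the topology demands. *)
Lemma returning_sheet_open (c : R) (i : bool) : 0 <= c < 1 ->
  open (returning_sheet c i).
Proof.
move=> /andP[c0 c1]; apply/open_returning_coverP => j; split.
  suff -> : [set x | returning_sheet c i (x, j)] =
      if j == i then [set x | x < c] else [set x | x > c].
    by case: ifP => _; [exact: open_lt|exact: open_gt].
  apply/seteqP; split=> x; rewrite /returning_sheet /=.
    move=> [/eqP xc ->]; have [cx|] := ltP c x.
      by rewrite addbT; case: i.
    by rewrite addbF eqxx /= lt_neqAle xc.
  case: eqVneq => [->|ij] /= xc; (split; first by apply/eqP; lra).
    by rewrite ltNge (ltW xc) addbF.
  by rewrite xc; case: i j ij => -[].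
move=> [/= _ ->]; rewrite ltNge c0/=.
near=> n; have n1 : (1 <= n%:R :> R).
  by rewrite ler1n; near: n; exact: nbhs_infty_gt.
split=> /=; first by apply/eqP; lra.
by rewrite (lt_le_trans c1 n1); case: i.
Unshelve. all: by end_near. Qed.

Lemma returning_proj_evenly_covered (c : R) : 0 <= c < 1 ->
  evenly_covered returning_proj [set x : R | x <> c].
Proof.
move=> c01; exists (range (returning_sheet c)); split.
- apply/seteqP; split=> [e [_ [i _ <-]] []//|e ec].
  (* The index comes from solving the equation of the sheet for [i]. *)
  exists (returning_sheet c (e.2 (+) (c < e.1))); first by eexists.
  by split => //; rewrite addbK.
- move=> _ _ [i _ <-] [j _ <-] [e [[_ ei] [_ ej]]]; congr returning_sheet.
  by apply: (@addIb (c < e.1)); rewrite -ei.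
- move=> _ [i _ <-]; split; first exact: returning_sheet_open.
  apply: open_map_sheet.
  + exact: returning_proj_continuous.
  + exact: returning_proj_open.
  + exact: returning_sheet_open.
  + move=> [x j] [y k]; rewrite !inE => -[/= _ ->] [/= _ ->].
    by rewrite /returning_proj /= => ->.
  + apply/seteqP; split=> [_ [e [ec _] <-]//|x xc].
    by exists (x, i (+) (c < x)).
Qed.

Lemma open_returning_line_neq (c : R) : 0 <= c < 1 ->
  open ([set x : R | x <> c] : set returning_line).
Proof.
move=> /andP[c0 c1]; apply/open_returning_lineP; split.
  suff -> : [set x : R | x <> c] = [set x | x < c] `|` [set x | x > c].
    by apply: openU; [exact: open_lt|exact: open_gt].
  apply/seteqP; split=> x /=.
    by move=> /eqP; rewrite neq_lt => /orP.
  by move=> xc; apply/eqP; rewrite neq_lt; apply/orP.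
move=> _; near=> n; apply/eqP; rewrite gt_eqF//.
by near: n; exact: nbhs_infty_gtr.
Unshelve. all: by end_near. Qed.

Lemma returning_proj_two_fold : two_fold_covering_map returning_proj.
Proof.
split; first split.
- exact: returning_proj_continuous.
- by move=> x _; exists (x, true).
(* Two evenly covered sets suffice: the complement of 0, and the complement of 1/2 for the point
   0. *)
- move=> x; have [c [c01 xc]] : exists c : R, 0 <= c < 1 /\ x <> c :> R.
    have [x0|x0] := pselect (x = 0 :> R); last by exists 0; split => //; lra.
    by exists 2^-1; split; [lra|rewrite x0; apply/eqP; lra].
  exists [set y : R | y <> c]; split => //.
    exact: open_returning_line_neq.
  exact: returning_proj_evenly_covered.
- move=> y; have -> : returning_proj @^-1` [set y] = pair y @` [set: bool].
    by apply/seteqP; split=> [[x i] /= <-|_ [i _ <-]//]; exists i.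
  have -> : `I_2 = nat_of_bool @` [set: bool].
    apply/seteqP; split=> [[|[|//]] _|_ [[] _ <-]//];
      by [exists false|exists true].
  apply: (card_eq_trans (B := [set: bool])); last rewrite card_eq_sym;
    by apply: inj_card_eq => -[] [] // _ _ [].
Qed.

(** * Connectedness of the cover *)

Lemma continuous_to_returning_line : continuous (idfun : R -> returning_line).
Proof. by apply/continuousP => U /open_returning_lineP[]. Qed.

Lemma continuous_to_returning_cover (i : bool) :
  continuous (fun x : R => (x, i) : returning_cover).
Proof. by apply/continuousP => U /open_returning_coverP/(_ i)[]. Qed.

Lemma connected_line : connected [set: R].
Proof. by apply/connected_intervalP => x y z. Qed.

Lemma returning_cover_connected : connected [set: returning_cover].
Proof.
pose L i : set returning_cover := range (fun x : R => (x, i)).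
have cL i : connected (L i).
  apply: connected_continuous_connected; first exact: connected_line.
  exact/continuous_subspaceT/continuous_to_returning_cover.
have -> : [set: returning_cover] = closure (L false) `|` L true.
  apply/seteqP; split=> // -[x []] _; [right|left]; first by exists x.
  by apply: subset_closure; exists x.
apply: connectedU => //; last exact: connected_closure.
(* The two connected pieces meet here: each neighbourhood of this origin contains far integers of
   the line [false]. *)
exists (0, true); split; last by exists 0.
move=> U; rewrite nbhsE => -[V [/open_returning_coverP oV V0] VU].
have [n Vn] := filter_ex ((oV true).2 V0).
by exists (n%:R, false); split; [exists n%:R|exact: VU].
Qed.

(** * Continuity of paths in the usual topology *)

Lemma open_returning_line_setU_gt (O : set R) (c : R) : open O ->
  open (O `|` [set x | c < x] : set returning_line).
Proof.
move=> oO; apply/open_returning_lineP; split.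
  by apply: openU => //; exact: open_gt.
by move=> _; near=> n; right; near: n; exact: nbhs_infty_gtr.
Unshelve. all: by end_near. Qed.

Lemma open_returning_line_pos (O : set R) : open O -> ~ O 0 ->
  open (O : set returning_line).
Proof. by move=> oO O0; apply/open_returning_lineP; split. Qed.

(** The line without the half-integers 1/2, 3/2, and so on. *)
Let separating_nbhs : set returning_line := [set x : R | x < 2^-1] `|`
  \bigcup_n [set x : R | n%:R + 2^-1 < x < n%:R + 1 + 2^-1].

Let separating_nbhs_open : open separating_nbhs.
Proof.
apply/open_returning_lineP; split.
  apply: openU; first exact: open_lt.
  apply: bigcup_open => n _.
  by rewrite -set_itvoo; exact: interval_open.
move=> _; near=> n; right.
have n0 : (0 < n)%N by near: n; exact: nbhs_infty_gt.
have nE : n%:R = n.-1%:R + 1 :> R by rewrite natr1 prednK.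
(* The integer [n] is the midpoint of the interval of index [n - 1]. *)
by exists n.-1 => //=; rewrite nE; lra.
Unshelve. all: by end_near. Qed.

(** Each bounded interval of the neighbourhood has a clopen trace on [A]. A nonempty trace would be
    all of [A], which contains 0. *)
Lemma connected_separating_nbhs (A : set returning_line) :
  connected A -> A 0 -> A `<=` separating_nbhs ->
  A `<=` [set x : R | x < 2^-1].
Proof.
move=> cA A0 AS x Ax; have [//|[m _ /= mx]] := AS _ Ax.
pose a := m%:R + 2^-1 : R.
have a0 : 0 < a by rewrite ltr_wpDl ?ler0n// invr_gt0 ltr0n.
have : A `&` [set y : R | a < y < a + 1] = A; last first.
  by move=> /seteqP[_ /(_ _ A0)[_ /=]]; lra.
apply: cA.
- by exists x; split => //=; rewrite /a; lra.
- exists [set y : R | a < y < a + 1] => //.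
  apply: open_returning_line_pos => /=; last by lra.
  by rewrite -set_itvoo; exact: interval_open.
(* The closed interval from [a] to [a + 1] is closed here, as its complement contains a ray; its
   trace is the same because [A] avoids the endpoints. *)
- exists (~` ([set y : R | y < a] `|` [set y | a + 1 < y])).
    exact/open_closedC/open_returning_line_setU_gt/open_lt.
  apply/seteqP; split=> y [Ay] /=.
    by move=> ay; split => // -[]; lra.
  move=> nay; split=> //; apply/andP; split; rewrite lt_neqAle leNgt.
    apply/andP; split; last by apply/negP => ?; apply: nay; left.
    apply/eqP => ya; have [/=|[n _ /=]] := AS _ Ay.
      by have := ler0n R m; rewrite -ya /a; lra.
    by rewrite -ya /a => ny; apply: (@natr_gap R n m); lra.
  apply/andP; split; last by apply/negP => ?; apply: nay; right.
  apply/eqP => ya; have [/=|[n _ /=]] := AS _ Ay; first by lra.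
  by rewrite ya /a => ny; apply: (@natr_gap R n m.+1); rewrite -natr1; lra.
Qed.

(** Where [h] is 0, small balls have connected images, which stay below 1/2 and never reach the far
    integers. Elsewhere, usual open sets without 0 are already open. *)
Lemma continuous_from_line (h : R -> returning_line) :
  continuous h -> continuous (h : R -> R).
Proof.
move=> ch s A; rewrite nbhsE => -[O [oO Os] OA].
have [hs0|hs0] := pselect (h s = 0 :> R).
  have sep : nbhs s (h @^-1` separating_nbhs).
    apply: ch; apply: open_nbhs_nbhs; split => //.
    by left; rewrite /= hs0 invr_gt0 ltr0n.
  have bdd : nbhs s (h @^-1` [set x : R | x < 2^-1]).
    have /nbhs_ballP[e e0 eS] := sep; apply/nbhs_ballP; exists e => // y sy.
    apply: (@connected_separating_nbhs (h @` ball s e)).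
    - apply: connected_continuous_connected; last exact: continuous_subspaceT.
      by apply/connected_intervalP; rewrite ball_itv; exact: interval_is_interval.
    - by rewrite -hs0; exists s => //; exact: ballxx.
    - by move=> _ [z sz <-]; exact: eS.
    - by exists y.
  (* The added ray makes the set open in the coarse topology, and [bdd] then cuts the ray off. *)
  have far : nbhs s (h @^-1` (O `|` [set x | 2^-1 < x])).
    apply: ch; apply: open_nbhs_nbhs; split; last by left.
    exact: open_returning_line_setU_gt.
  apply: filterS2 bdd far => y /= y2 [/OA//|]; lra.
have : nbhs s (h @^-1` (O `&` [set x : R | x <> 0])).
  apply: ch; apply: open_nbhs_nbhs; split => //.
  apply: open_returning_line_pos; last by case.
  apply: openI => //.
  by have /open_returning_lineP[] := @open_returning_line_neq 0 ltac:(lra).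
by apply: filterS => y [/OA].
Qed.

(** Clamping extends the path to the whole line, where balls are intervals. *)
Lemma continuous_from_unit_interval (f : unit_interval R -> returning_line) :
  continuous f -> continuous (f : unit_interval R -> R).
Proof.
move=> cf; have ch : continuous ((f \o @clamp R) : R -> R).
  apply: continuous_from_line => t.
  by apply: continuous_comp; [exact: clamp_continuous|exact: cf].
have -> : (f : unit_interval R -> R) = (f \o @clamp R) \o @uval R.
  by apply/funext => t /=; rewrite uvalK.
move=> t; apply: continuous_comp; first exact: uval_continuous.
exact: ch.
Qed.

(** * Simple connectedness *)

Lemma returning_line_simply_connected : simply_connected R returning_line.
Proof.
split; first split; first by exists 0.
  move=> x y.
  pose f (t : unit_interval R) : R := (y - x : R) * uval t + x.
  have cf : continuous (f : unit_interval R -> returning_line).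
    move=> t; apply: (@continuous_comp _ _ _ f
      (idfun : R -> returning_line)); last exact: continuous_to_returning_line.
    exact: continuous_affine (@uval_continuous R) _.
  have f0 : f zero = x by rewrite /f uval0 mulr0 add0r.
  have f1 : f one = y by rewrite /f uval1 mulr1 subrK.
  pose g : upath R x y := mk_path cf f0 f1.
  exact: (squash g).
move=> x a; rewrite -[a]loop_class_repr; apply/loop_class_eqP.
set f := repr a.
(* With [f] continuous into [R], the straight-line homotopy to [x] is continuous into [R], hence
   into the coarser topology. *)
have cf : continuous (f : unit_interval R -> R).
  by apply: continuous_from_unit_interval; exact: cts_fun.
pose H (ts : unit_interval R * unit_interval R) : R :=
  (1 - uval ts.2) * (f ts.1 : R) + uval ts.2 * (x : R).
exists H; split.
- move=> ts; apply: (@continuous_comp _ _ _ H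
    (idfun : R -> returning_line)); last exact: continuous_to_returning_line.
  apply: cvgD; apply: cvgM.
  + exact: continuous_onem (@continuous_uval2 R) _.
  + by apply: continuous_comp; [exact: cvg_fst|exact: cf].
  + exact: continuous_uval2.
  + exact: cvg_cst.
- split=> t; rewrite /H/= ?uval0 ?uval1.
    by rewrite subr0 mul1r mul0r addr0.
  by rewrite subrr mul1r mul0r add0r.
- by move=> s; rewrite /H/= path_zero -mulrDl subrK mul1r.
- by move=> s; rewrite /H/= path_one -mulrDl subrK mul1r.
Qed.

Lemma returning_line_connected : connected [set: returning_line].
Proof.
have -> : [set: returning_line] = (idfun : R -> returning_line) @` setT.
  by rewrite image_id.
apply: connected_continuous_connected; first exact: connected_line.
exact/continuous_subspaceT/continuous_to_returning_line.
Qed.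

End returning_line.

Theorem mainTheorem1 (R : realType) :
  exists (E B : topologicalType) (p : E -> B),
    [/\ connected [set: E], connected [set: B], simply_connected R B &
        two_fold_covering_map p].
Proof.
exists (returning_cover R), (returning_line R), (@returning_proj R); split.
- exact: returning_cover_connected.
- exact: returning_line_connected.
- exact: returning_line_simply_connected.
- exact: returning_proj_two_fold.
Qed.
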